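(* Let $f,g\in\mathbb{C}[x_1,\ldots,x_n]$ be two non-constant polynomials, and let $m\ge 0$ and $N\ge 1$ be integers. Let $$J=I_{m+N}(s)+\sum_{k=1}^N D[s]\,f^kg^{N-k}\subset D[s].$$ Then $$\pi\bigl(\mathrm{syz}_{D[s]}(g^N,J)\bigr)\cap\mathbb{C}[s]=\Bigl\langle b^{(N)}_{\frac fg,m}(s)\Bigr\rangle$$ as ideals of $\mathbb{C}[s]$.
   Context: $D=\mathbb{C}[x_1,\ldots,x_n]\langle\partial_1,\ldots,\partial_n\rangle$ is the $n$th Weyl algebra over $\mathbb{C}$ (with $\partial_i x_i=x_i\partial_i+1$) and $D[s]=D\otimes_{\mathbb{C}}\mathbb{C}[s]$, with $s$ a central variable. The free rank-one module $\mathbb{C}[x,s,\frac1{fg}]\left(\frac fg\right)^s$ is a left $D[s]$-module: polynomials in $x,s$ act by multiplication and $\partial_i\bullet u\left(\frac fg\right)^s=\left(\frac{\partial u}{\partial x_i}+s\,u\,\frac{\partial f/\partial x_i}{f}-s\,u\,\frac{\partial g/\partial x_i}{g}\right)\left(\frac fg\right)^s$ for $u\in\mathbb{C}[x,s,\frac1{fg}]$. Here $\left(\frac fg\right)^{s+k}$ means $\frac{f^k}{g^k}\left(\frac fg\right)^s$. For an integer $k\ge0$, $I_k(s)=\mathrm{Ann}_{D[s]}\frac1{g^k}\left(\frac fg\right)^s\subset D[s]$. $b^{(N)}_{\frac fg,m}(s)$ is the monic generator (or $0$ if the ideal is zero) of the ideal of $\mathbb{C}[s]$ consisting of all $b(s)\in\mathbb{C}[s]$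 for which there exist $P_1(s),\ldots,P_N(s)\in D[s]$ with $b(s)\frac1{g^m}\left(\frac fg\right)^s=\sum_{k=1}^N P_k(s)\frac1{g^m}\left(\frac fg\right)^{s+k}$. For $P\in D[s]$ and a left ideal $I\subset D[s]$ generated by $Q_1,\ldots,Q_r$, $\mathrm{syz}_{D[s]}(P,I)$ denotes the left syzygy module $\{(A,R_1,\ldots,R_r)\in D[s]^{r+1}\mid AP+\sum_jR_jQ_j=0\}$, and $\pi:D[s]^{r+1}\to D[s]$ is the projection onto the first factor; thus $\pi(\mathrm{syz}_{D[s]}(P,I))=\{A\in D[s]\mid AP\in I\}$, independently of the chosen generators. *)

(* Defs.v *)
From HB Require Import structures.
From mathcomp Require Import all_boot all_order all_algebra.
From mathcomp Require Import generic_quotient ring_quotient fraction.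
From mathcomp Require Import complex boolp classical_sets reals.
From mathcomp Require Import finmap.
From mathcomp Require Import -(notations) monalg.
From mathcomp Require Import mpoly.
From mathcomp.algebra_tactics Require Import ring.

Set Implicit Arguments.
Unset Strict Implicit.
Unset Printing Implicit Defensive.

Import GRing.Theory.
Local Open Scope ring_scope.
Local Open Scope quotient_scope.

(** * The Weyl algebra *)

(* The n-th Weyl algebra over [K] is presented as the quotient of the free
   associative algebra on x_1, ..., x_n, d_1, ..., d_n (the monoid algebra of
   words in ['I_n + 'I_n], [inl i] standing for x_i and [inr i] for d_i) by the
   two-sided ideal generated by the commutation relations. *)
Section WeylAlgebra.
Variables (K : fieldType) (n : nat).

Definition weyl_free : nzRingType := malg (fmonom ('I_n + 'I_n)%type) K.

Definition free_x (i : 'I_n) : weyl_free := mkmalgU (fmu (inl i)) 1.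
Definition free_d (i : 'I_n) : weyl_free := mkmalgU (fmu (inr i)) 1.

Variant weyl_rel : weyl_free -> Prop :=
| weyl_rel_xx i j : weyl_rel (free_x i * free_x j - free_x j * free_x i)
| weyl_rel_dd i j : weyl_rel (free_d i * free_d j - free_d j * free_d i)
| weyl_rel_dx i j :
    weyl_rel (free_d i * free_x j - free_x j * free_d i - (i == j)%:R).

Definition two_sided_ideal (I : weyl_free -> Prop) :=
  [/\ I 0, forall a b, I a -> I b -> I (a - b),
      forall a b, I b -> I (a * b) & forall a b, I a -> I (a * b)].

Definition weyl_ideal : pred weyl_free := fun a =>
  `[< forall I, two_sided_ideal I -> (forall r, weyl_rel r -> I r) -> I a >].

Lemma weyl_idealP a :
  reflect (forall I, two_sided_ideal I -> (forall r, weyl_rel r -> I r) -> I a)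
          (a \in weyl_ideal).
Proof. exact: asboolP. Qed.

Lemma weyl_ideal_rel r : weyl_rel r -> r \in weyl_ideal.
Proof. by move=> rr; apply/weyl_idealP => I _; apply. Qed.

Lemma weyl_ideal_zmod_closed : zmod_closed weyl_ideal.
Proof.
split; first by apply/weyl_idealP => I [].
move=> a b /weyl_idealP Ia /weyl_idealP Ib; apply/weyl_idealP => I hI hr.
by have [_ + _ _] := hI; apply; [apply: Ia | apply: Ib].
Qed.
HB.instance Definition _ :=
  GRing.isZmodClosed.Build weyl_free weyl_ideal weyl_ideal_zmod_closed.

Lemma weyl_idealMl a b : b \in weyl_ideal -> a * b \in weyl_ideal.
Proof.
move=> /weyl_idealP Ib; apply/weyl_idealP => I hI hr.
by have [_ _ + _] := hI; apply; apply: Ib.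
Qed.

Lemma weyl_idealMr a b : a \in weyl_ideal -> a * b \in weyl_ideal.
Proof.
move=> /weyl_idealP Ia; apply/weyl_idealP => I hI hr.
by have [_ _ _ +] := hI; apply; apply: Ia.
Qed.

(** Action of the free algebra on an [A]-module [V], where [A] is a
    [K]-algebra through [phi] and the generators act by given operators. *)
Section FreeAction.
Variables (A : comNzRingType) (phi : {rmorphism K -> A}) (V : lmodType A).
Variables (ox od : 'I_n -> {additive V -> V}).
Hypothesis oxZ : forall i c v, ox i (phi c *: v) = phi c *: ox i v.
Hypothesis odZ : forall i c v, od i (phi c *: v) = phi c *: od i v.

Definition gen_act (t : ('I_n + 'I_n)%type) : V -> V :=
  match t with inl i => ox i | inr i => od i end.

Definition word_act (w : seq ('I_n + 'I_n)%type) (v : V) : V := foldr gen_act v w.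

Definition free_act (a : weyl_free) (v : V) : V :=
  \sum_(w <- monalg.msupp a) phi (monalg.mcoeff w a) *: word_act w v.

Lemma gen_actB t : {morph gen_act t : u v / u - v}.
Proof. by case: t => i u v; rewrite /= raddfB. Qed.

Lemma word_actB w : {morph word_act w : u v / u - v}.
Proof. by move=> u v; elim: w => //= t w ->; rewrite gen_actB. Qed.

Lemma word_actZ w c v : word_act w (phi c *: v) = phi c *: word_act w v.
Proof. by elim: w => //= -[] i w -> /=; rewrite (oxZ, odZ). Qed.

Lemma free_act_is_additive a : zmod_morphism (free_act a).
Proof.
move=> u v; rewrite /free_act -sumrB; apply: eq_bigr => w _.
by rewrite word_actB scalerBr.
Qed.
HB.instance Definition _ a :=
  GRing.isZmodMorphism.Build V V (free_act a) (free_act_is_additive a).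

Lemma free_actEw (d : {fset fmonom ('I_n + 'I_n)%type}) a v :
  fsubset (monalg.msupp a) d ->
  free_act a v = \sum_(w <- d) phi (monalg.mcoeff w a) *: word_act w v.
Proof.
move=> le; rewrite /free_act (big_fset_incl _ le) //= => x _ /mcoeff_outdom ->.
by rewrite rmorph0 scale0r.
Qed.

Lemma free_actDl a b v : free_act (a + b) v = free_act a v + free_act b v.
Proof.
pose d := fsetU (monalg.msupp a) (monalg.msupp b).
rewrite (@free_actEw d (a + b)) ?(@free_actEw d a) ?(@free_actEw d b)
  ?fsubsetUl ?fsubsetUr ?monalg.msuppD_le //.
rewrite -big_split; apply: eq_bigr => w _.
by rewrite monalg.mcoeffD rmorphD scalerDl.
Qed.

Lemma free_actU c w v : free_act (mkmalgU w c) v = phi c *: word_act w v.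
Proof.
by rewrite (@free_actEw [fset w]%fset) ?msuppU_le // big_seq_fset1 mcoeffUU.
Qed.

Lemma free_act0l v : free_act 0 v = 0.
Proof. by rewrite /free_act monalg.msupp0 big_seq_fset0. Qed.

Lemma free_actNl a v : free_act (- a) v = - free_act a v.
Proof.
by apply/eqP; rewrite -addr_eq0 -free_actDl addNr free_act0l.
Qed.

Lemma free_act_suml (T : Type) (r : seq T) (F : T -> weyl_free) v :
  free_act (\sum_(t <- r) F t) v = \sum_(t <- r) free_act (F t) v.
Proof.
by apply: (big_morph (fun a => free_act a v)) => [a b|];
  rewrite (free_actDl, free_act0l).
Qed.

Lemma free_actM a b v : free_act (a * b) v = free_act a (free_act b v).
Proof.
rewrite monalg.malgME free_act_suml [RHS]/free_act; apply: eq_bigr => w1 _.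
have -> : word_act w1 (free_act b v)
    = \sum_(w <- monalg.msupp b)
        phi (monalg.mcoeff w b) *: word_act w1 (word_act w v).
  have h0 : word_act w1 0 = 0 by rewrite -[X in word_act _ X](subrr 0)
    word_actB subrr.
  have hD : {morph word_act w1 : u v / u + v}.
    by move=> x y; rewrite -{1}[y]opprK word_actB -[- y]sub0r word_actB h0
      sub0r opprK.
  by rewrite (big_morph _ hD h0); apply: eq_bigr => w _; rewrite word_actZ.
rewrite free_act_suml scaler_sumr; apply: eq_bigr => w2 _.
by rewrite free_actU fmM /word_act foldr_cat rmorphM scalerA.
Qed.

Lemma free_act1 v : free_act 1 v = v.
Proof. by rewrite free_actU rmorph1 scale1r fm1. Qed.

Lemma free_act_x i v : free_act (free_x i) v = ox i v.
Proof. by rewrite free_actU rmorph1 scale1r fmU. Qed.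

Lemma free_act_d i v : free_act (free_d i) v = od i v.
Proof. by rewrite free_actU rmorph1 scale1r fmU. Qed.

Hypothesis oxx : forall i j v, ox i (ox j v) = ox j (ox i v).
Hypothesis odd_ : forall i j v, od i (od j v) = od j (od i v).
Hypothesis odx :
  forall i j v, od i (ox j v) = ox j (od i v) + v *+ (i == j).

Lemma free_act_ideal a v : a \in weyl_ideal -> free_act a v = 0.
Proof.
move=> /weyl_idealP /(_ (fun a => forall v, free_act a v = 0)) h.
apply: h => [|r]; first split.
- exact: free_act0l.
- by move=> {}a b ha hb w; rewrite free_actDl free_actNl ha hb subr0.
- by move=> {}a b hb w; rewrite free_actM hb raddf0.
- by move=> {}a b ha w; rewrite free_actM ha.
case=> i j w; rewrite !(free_actDl, free_actNl, free_actM).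
- by rewrite !free_act_x oxx subrr.
- by rewrite !free_act_d odd_ subrr.
rewrite !free_act_x !free_act_d odx [ox j _ + _]addrC addrK.
by case: (i == j); rewrite /= ?free_act1 ?free_act0l subrr.
Qed.

End FreeAction.

Definition mpoly_x (i : 'I_n) : {mpoly K[n]} -> {mpoly K[n]} := *%R 'X_i.
Lemma mpoly_x_is_additive i : zmod_morphism (mpoly_x i).
Proof. exact: mulrBr. Qed.
HB.instance Definition _ i :=
  GRing.isZmodMorphism.Build _ _ (mpoly_x i) (mpoly_x_is_additive i).

Lemma weyl_ideal_proper : 1 \notin weyl_ideal.
Proof.
apply/negP => h1; pose od i : {additive {mpoly K[n]} -> {mpoly K[n]}} :=
  GRing.Additive.clone _ _ (mderiv i) _.
have := @free_act_ideal K (GRing.RMorphism.clone _ _ idfun _) _ mpoly_x od.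
move=> /(_ _ _ _ _ _ 1 1 h1); rewrite free_act1 => h.
have /eqP : (1 : {mpoly K[n]}) = 0; last by rewrite oner_eq0.
apply: h.
- by move=> i c v; rewrite /= /mpoly_x scalerAr.
- by move=> i c v; rewrite /= mderivZ.
- by move=> i j v; rewrite /= /mpoly_x mulrCA.
- by move=> i j v; rewrite /= mderiv_comm.
move=> i j v; rewrite /= /mpoly_x mderivM addrC; congr (_ + _).
rewrite mderivX mnmE; case: (eqVneq j i) => [->|_].
  have -> : (U_(i) - U_(i) = 0)%MM by apply/mnmP => k; rewrite !mnmE subnn.
  by rewrite scale1r mpolyX0 mul1r.
by rewrite mulr0n scale0r mul0r.
Qed.

Definition weyl : Type :=
  Quotient.quot (GRing.ZmodClosed.clone weyl_free weyl_ideal _).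
HB.instance Definition _ := GRing.Zmodule.on weyl.
HB.instance Definition _ := EqQuotient.on weyl.

Definition weyl_pi (a : weyl_free) : weyl := \pi_weyl a.

Lemma weyl_piP a b : weyl_pi a = weyl_pi b <-> a - b \in weyl_ideal.
Proof. by rewrite Quotient.idealrBE; split=> [/eqP|/eqP]. Qed.

Lemma weyl_piK P : weyl_pi (repr P) = P.
Proof. exact: reprK. Qed.

Lemma weyl_pi_is_additive : zmod_morphism weyl_pi.
Proof. by move=> a b; rewrite /weyl_pi !piE. Qed.
HB.instance Definition _ :=
  GRing.isZmodMorphism.Build weyl_free weyl weyl_pi weyl_pi_is_additive.

Definition weyl_mul (P Q : weyl) : weyl := weyl_pi (repr P * repr Q).

Lemma weyl_pi_mul a b : weyl_pi (a * b) = weyl_mul (weyl_pi a) (weyl_pi b).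
Proof.
have hr c : c - repr (weyl_pi c) \in weyl_ideal.
  by apply/weyl_piP; rewrite weyl_piK.
apply/weyl_piP.
have -> : a * b - repr (weyl_pi a) * repr (weyl_pi b)
    = a * (b - repr (weyl_pi b)) + (a - repr (weyl_pi a)) * repr (weyl_pi b).
  by rewrite mulrBr mulrBl addrA subrK.
by apply: rpredD; [apply: weyl_idealMl | apply: weyl_idealMr].
Qed.

Lemma weyl_mulA : associative weyl_mul.
Proof.
move=> P Q S; rewrite -[P]weyl_piK -[Q]weyl_piK -[S]weyl_piK.
by rewrite -!weyl_pi_mul mulrA.
Qed.
Lemma weyl_mul1l : left_id (weyl_pi 1) weyl_mul.
Proof. by move=> P; rewrite -[P]weyl_piK -weyl_pi_mul mul1r. Qed.
Lemma weyl_mul1r : right_id (weyl_pi 1) weyl_mul.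
Proof. by move=> P; rewrite -[P]weyl_piK -weyl_pi_mul mulr1. Qed.
Lemma weyl_mulDl : left_distributive weyl_mul +%R.
Proof.
move=> P Q S; rewrite -[P]weyl_piK -[Q]weyl_piK -[S]weyl_piK.
by rewrite -raddfD -!weyl_pi_mul mulrDl raddfD.
Qed.
Lemma weyl_mulDr : right_distributive weyl_mul +%R.
Proof.
move=> P Q S; rewrite -[P]weyl_piK -[Q]weyl_piK -[S]weyl_piK.
by rewrite -raddfD -!weyl_pi_mul mulrDr raddfD.
Qed.
Lemma weyl_1_neq0 : weyl_pi 1 != 0.
Proof.
by apply/eqP; rewrite -(raddf0 weyl_pi) => /weyl_piP;
  rewrite subr0; apply/negP; exact: weyl_ideal_proper.
Qed.
HB.instance Definition _ := GRing.Zmodule_isNzRing.Build weyl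
  weyl_mulA weyl_mul1l weyl_mul1r weyl_mulDl weyl_mulDr weyl_1_neq0.

Lemma weyl_pi_is_monoid_morphism : monoid_morphism weyl_pi.
Proof. by split; [exact: erefl | exact: weyl_pi_mul]. Qed.
HB.instance Definition _ := GRing.isMonoidMorphism.Build weyl_free weyl weyl_pi
  weyl_pi_is_monoid_morphism.

Definition weyl_x i : weyl := weyl_pi (free_x i).
Definition weyl_d i : weyl := weyl_pi (free_d i).

Definition weyl_const (c : K) : weyl := weyl_pi (mkmalgU mone c).
Lemma weyl_const_is_additive : zmod_morphism weyl_const.
Proof. by move=> a b; rewrite /weyl_const monalgUB raddfB. Qed.
HB.instance Definition _ :=
  GRing.isZmodMorphism.Build K weyl weyl_const weyl_const_is_additive.
Lemma weyl_const_is_monoid_morphism : monoid_morphism weyl_const.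
Proof.
split=> [|a b]; rewrite /weyl_const; first exact: rmorph1.
by rewrite monalg.mpolyCM rmorphM.
Qed.
HB.instance Definition _ :=
  GRing.isMonoidMorphism.Build K weyl weyl_const weyl_const_is_monoid_morphism.

Lemma weyl_xx i j : weyl_x i * weyl_x j = weyl_x j * weyl_x i.
Proof.
by rewrite -!(rmorphM (@weyl_pi)); apply/weyl_piP; exact: weyl_ideal_rel (weyl_rel_xx _ _).
Qed.
Lemma weyl_dd i j : weyl_d i * weyl_d j = weyl_d j * weyl_d i.
Proof.
by rewrite -!(rmorphM (@weyl_pi)); apply/weyl_piP; exact: weyl_ideal_rel (weyl_rel_dd _ _).
Qed.
Lemma weyl_dx i j : weyl_d i * weyl_x j = weyl_x j * weyl_d i + (i == j)%:R.
Proof.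
rewrite -!(rmorphM (@weyl_pi)) -(rmorph_nat weyl_pi) -rmorphD; apply/weyl_piP.
by rewrite opprD addrA; exact: weyl_ideal_rel (weyl_rel_dx _ _).
Qed.

(* The inclusion of K[x_1, ..., x_n] in the Weyl algebra. *)
Definition weyl_poly (p : {mpoly K[n]}) : weyl := mmap weyl_const weyl_x p.

End WeylAlgebra.

(** * The ring K[x_1, ..., x_n, 1/h] and its partial derivatives *)

Notation "p %:F" := (@FracField.tofrac _ p) : ring_scope.

Section FractionIdentities.
Variables (R : idomainType) (F : fieldType) (phi : {rmorphism R -> F}).
Variables (p q r t p' q' r' t' : R).
Hypotheses (q0 : phi q != 0) (t0 : phi t != 0).

Lemma frac_subE : phi p / phi q - phi r / phi t = phi (p * t - r * q) / phi (q * t).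
Proof. by rewrite rmorphB !rmorphM; field; rewrite q0 t0. Qed.

Lemma frac_mulE : phi p / phi q * (phi r / phi t) = phi (p * r) / phi (q * t).
Proof. by rewrite !rmorphM; field; rewrite q0 t0. Qed.

Lemma quotient_ruleB :
  phi (((p' * t + p * t') - (r' * q + r * q')) * (q * t)
    - (p * t - r * q) * (q' * t + q * t')) / phi ((q * t) ^+ 2)
  = phi (p' * q - p * q') / phi (q ^+ 2) - phi (r' * t - r * t') / phi (t ^+ 2).
Proof.
rewrite !(rmorphB, rmorphD, rmorphM, rmorphXn).
by field; rewrite q0 t0.
Qed.

Lemma quotient_ruleM :
  phi ((p' * r + p * r') * (q * t) - p * r * (q' * t + q * t'))
    / phi ((q * t) ^+ 2)
  = phi (p' * q - p * q') / phi (q ^+ 2) * (phi r / phi t)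
    + phi p / phi q * (phi (r' * t - r * t') / phi (t ^+ 2)).
Proof.
rewrite !(rmorphB, rmorphD, rmorphM, rmorphXn).
by field; rewrite q0 t0.
Qed.

End FractionIdentities.

Lemma cancel_terms (V : zmodType) (x a b c : V) :
  x = x + a + (b + c) - b - a - c.
Proof.
by rewrite [b + c]addrC !addrA addrK addrAC addrK addrK.
Qed.

Section Localization.
Variables (K : fieldType) (n : nat).
Local Notation P := {mpoly K[n]}.

Lemma frac_repr (u : {fraction P}) :
  u * (\d_(repr u))%:F = (\n_(repr u))%:F.
Proof.
rewrite -{1}[u]reprK; unlock FracField.tofrac.
rewrite -[LHS]FracField.pi_mul; apply/eqmodP => /=.
rewrite FracField.equivfE /FracField.mulf.
by rewrite !numden_Ratio ?mulf_neq0 ?oner_neq0 ?denom_ratioP // !mulr1 mulrC.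
Qed.

Lemma fracP (u : {fraction P}) : exists p q : P, q != 0 /\ u = p%:F / q%:F.
Proof.
exists (\n_(repr u)), (\d_(repr u)); split; first exact: denom_ratioP.
by rewrite -frac_repr mulfK ?tofrac_eq0 ?denom_ratioP.
Qed.

(* The quotient rule, on the representative chosen by the library. *)
Definition frac_deriv (i : 'I_n) (u : {fraction P}) : {fraction P} :=
  ((\n_(repr u))^`M(i) * \d_(repr u) - \n_(repr u) * (\d_(repr u))^`M(i))%:F
    / ((\d_(repr u)) ^+ 2)%:F.

Lemma frac_derivE i (p q : P) : q != 0 ->
  frac_deriv i (p%:F / q%:F) = (p^`M(i) * q - p * q^`M(i))%:F / (q ^+ 2)%:F.
Proof.
move=> q0; rewrite /frac_deriv; set u := p%:F / q%:F.
have d0 := denom_ratioP (repr u); set a := \n_(repr u); set d := \d_(repr u).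
have h : p * d = q * a.
  apply/eqP; rewrite -tofrac_eq !tofracM; apply/eqP.
  have -> : p%:F = u * q%:F by rewrite divfK ?tofrac_eq0.
  by rewrite -frac_repr -/d mulrAC mulrC.
apply/eqP; rewrite eqr_div ?tofrac_eq0 ?expf_neq0 // -!tofracM tofrac_eq.
apply/eqP; have h' := congr1 (mderiv i) h; rewrite !mderivM in h'.
transitivity (q * d * (p^`M(i) * d + p * d^`M(i)) - q^`M(i) * d * (p * d)
  - q * d^`M(i) * (p * d)); last by ring.
by rewrite h' h; ring.
Qed.

Lemma frac_deriv_tofrac i p : frac_deriv i p%:F = (p^`M(i))%:F.
Proof.
rewrite -[p%:F]divr1 -tofrac1 frac_derivE ?oner_neq0 // mderivC mulr0 subr0.
by rewrite mulr1 expr1n tofrac1 divr1.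
Qed.

Lemma frac_deriv_is_additive i : zmod_morphism (frac_deriv i).
Proof.
move=> u v; have [p [q [q0 ->]]] := fracP u; have [r [t [t0 ->]]] := fracP v.
have qF : q%:F != 0 by rewrite tofrac_eq0.
have tF : t%:F != 0 by rewrite tofrac_eq0.
rewrite (frac_subE p r qF tF).
rewrite (frac_derivE i _ q0) (frac_derivE i _ t0) frac_derivE ?mulf_neq0 //.
rewrite mderivB.
rewrite (mderivM i p t) (mderivM i r q) (mderivM i q t).
have H := (quotient_ruleB p r p^`M(i) q^`M(i) r^`M(i) t^`M(i) qF tF).
exact: H.
Qed.
HB.instance Definition _ i :=
  GRing.isZmodMorphism.Build _ _ (frac_deriv i) (frac_deriv_is_additive i).

Lemma frac_derivM i u v :
  frac_deriv i (u * v) = frac_deriv i u * v + u * frac_deriv i v.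
Proof.
have [p [q [q0 ->]]] := fracP u; have [r [t [t0 ->]]] := fracP v.
have qF : q%:F != 0 by rewrite tofrac_eq0.
have tF : t%:F != 0 by rewrite tofrac_eq0.
rewrite (frac_mulE p r qF tF).
rewrite (frac_derivE i _ q0) (frac_derivE i _ t0) frac_derivE ?mulf_neq0 //.
rewrite (mderivM i p r) (mderivM i q t).
exact: (quotient_ruleM p r p^`M(i) q^`M(i) r^`M(i) t^`M(i) qF tF).
Qed.

Lemma frac_deriv_comm i j u :
  frac_deriv i (frac_deriv j u) = frac_deriv j (frac_deriv i u).
Proof.
have [p [q [q0 uE]]] := fracP u; have qF : q%:F != 0 by rewrite tofrac_eq0.
have uq : u * q%:F = p%:F by rewrite uE divfK.
have e k l : frac_deriv k (frac_deriv l u) * q%:F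
   = (p^`M(l)^`M(k))%:F - frac_deriv k u * (q^`M(l))%:F
     - frac_deriv l u * (q^`M(k))%:F - u * (q^`M(l)^`M(k))%:F.
  rewrite -!frac_deriv_tofrac -uq. rewrite (frac_derivM l u) raddfD /=. 
  rewrite (frac_derivM k (frac_deriv l u)) (frac_derivM k u (frac_deriv l q%:F)).
  exact: cancel_terms.
apply: (mulIf qF).
by rewrite (e i j) (e j i) (mderiv_comm i j p) (mderiv_comm i j q)
  [_ - _ - frac_deriv j u * _]addrAC.
Qed.

Variable h : P.

Definition loc_pred : pred {fraction P} := fun u =>
  `[< exists (p : P) (k : nat), u = p%:F / h%:F ^+ k >].

Lemma loc_predP u :
  reflect (exists (p : P) (k : nat), u = p%:F / h%:F ^+ k) (u \in loc_pred).
Proof. exact: asboolP. Qed.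

Lemma loc_pred0 u : h = 0 -> (u \in loc_pred) -> exists p : P, u = p%:F.
Proof.
move=> h0 /loc_predP[p [[|k] ->]].
  by exists p; rewrite expr0 divr1.
by exists 0; rewrite h0 tofrac0 expr0n invr0 mulr0.
Qed.

Lemma loc_pred_frac p k : p%:F / h%:F ^+ k \in loc_pred.
Proof. by apply/loc_predP; exists p, k. Qed.

Lemma loc_pred_tofrac (p : P) : p%:F \in loc_pred.
Proof. by apply/loc_predP; exists p, 0%N; rewrite expr0 divr1. Qed.

Lemma loc_subring_closed : subring_closed loc_pred.
Proof.
have [h0|h0] := eqVneq h 0.
  split; first by rewrite -tofrac1 loc_pred_tofrac.
    move=> u v /(loc_pred0 h0)[p ->] /(loc_pred0 h0)[q ->].
    by rewrite -tofracB loc_pred_tofrac.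
  move=> u v /(loc_pred0 h0)[p ->] /(loc_pred0 h0)[q ->].
  by rewrite -tofracM loc_pred_tofrac.
have hF : h%:F != 0 by rewrite tofrac_eq0.
split; first by rewrite -tofrac1 loc_pred_tofrac.
- move=> u v /loc_predP[p [k ->]] /loc_predP[q [l ->]]; apply/loc_predP.
  exists (p * h ^+ l - q * h ^+ k), (k + l)%N.
  rewrite exprD -(tofracXn k h) -(tofracXn l h) -tofracM.
  by apply: frac_subE; rewrite tofrac_eq0 expf_neq0.
- move=> u v /loc_predP[p [k ->]] /loc_predP[q [l ->]]; apply/loc_predP.
  by exists (p * q), (k + l)%N; rewrite mulf_div (tofracM p q) exprD.
Qed.
HB.instance Definition _ :=
  GRing.isSubringClosed.Build _ loc_pred loc_subring_closed.

(* The subring K[x_1, ..., x_n, 1/h] of K(x_1, ..., x_n), for [h != 0]. *)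
Record loc := Loc { loc_val : {fraction P}; loc_valP : loc_val \in loc_pred }.
HB.instance Definition _ := [isSub for loc_val].
HB.instance Definition _ := [Choice of loc by <:].
HB.instance Definition _ := [SubChoice_isSubComNzRing of loc by <:].

(* p / h^k *)
Definition loc_frac (p : P) (k : nat) : loc := Loc (loc_pred_frac p k).

Definition loc_poly (p : P) : loc := Loc (loc_pred_tofrac p).

Lemma loc_poly_is_additive : zmod_morphism loc_poly.
Proof. by move=> p q; apply: val_inj; rewrite raddfB /= tofracB. Qed.
HB.instance Definition _ :=
  GRing.isZmodMorphism.Build _ _ loc_poly loc_poly_is_additive.
Lemma loc_poly_is_monoid_morphism : monoid_morphism loc_poly.
Proof.
by split=> [|p q]; apply: val_inj; rewrite ?rmorph1 ?rmorphM /= ?tofrac1 ?tofracM.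
Qed.
HB.instance Definition _ :=
  GRing.isMonoidMorphism.Build _ _ loc_poly loc_poly_is_monoid_morphism.

Lemma loc_pred_deriv i u : u \in loc_pred -> frac_deriv i u \in loc_pred.
Proof.
have [h0 /(loc_pred0 h0)[p ->]|h0] := eqVneq h 0.
  by rewrite frac_deriv_tofrac loc_pred_tofrac.
move=> /loc_predP[p [k ->]]; apply/loc_predP.
exists (p^`M(i) * h ^+ k - p * (h ^+ k)^`M(i)), (k * 2)%N.
by rewrite -tofracXn frac_derivE ?expf_neq0 // !tofracXn exprM.
Qed.

Definition loc_deriv (i : 'I_n) (u : loc) : loc :=
  Loc (loc_pred_deriv i (loc_valP u)).

Lemma loc_deriv_is_additive i : zmod_morphism (loc_deriv i).
Proof. by move=> u v; apply: val_inj; rewrite /= !raddfB. Qed.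
HB.instance Definition _ i :=
  GRing.isZmodMorphism.Build _ _ (loc_deriv i) (loc_deriv_is_additive i).

Lemma loc_derivM i u v :
  loc_deriv i (u * v) = loc_deriv i u * v + u * loc_deriv i v.
Proof. by apply: val_inj; rewrite /= frac_derivM. Qed.

Lemma loc_deriv_poly i p : loc_deriv i (loc_poly p) = loc_poly p^`M(i).
Proof. by apply: val_inj; rewrite /= frac_deriv_tofrac. Qed.

Lemma loc_deriv_comm i j u :
  loc_deriv i (loc_deriv j u) = loc_deriv j (loc_deriv i u).
Proof. by apply: val_inj; rewrite /= frac_deriv_comm. Qed.

End Localization.

(** * The module K[x, s, 1/(fg)] (f/g)^s *)

Section RingIdentities.
Variable R : comNzRingType.
Implicit Types a b c d e u v w x y : R.

Lemma twistB a b x u v w :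
  a - b + x * (u - v) * w = a + x * u * w - (b + x * v * w).
Proof. by ring. Qed.

Lemma twistM a b x u v w : a * u + v * b + x * (v * u) * w
  = a * u + v * (b + x * u * w).
Proof. by ring. Qed.

Lemma twistC x u a b c v w d :
  a + (x * b * w + x * u * d) + x * (c + x * u * w) * v
  = a + (x * c * v + x * u * d) + x * (b + x * u * v) * w.
Proof. by ring. Qed.

Lemma dlogC a b c d x y u v : 
  a * x + b * - (c * x ^+ 2) - (d * y + u * - (v * y ^+ 2))
  = a * x + c * - (b * x ^+ 2) - (d * y + v * - (u * y ^+ 2)).
Proof. by ring. Qed.
End RingIdentities.

(* [A] is a K[x_1, ..., x_n]-algebra through [phi], with commuting derivations
   [d i] extending the partial derivatives, and [w] is a closed 1-form. *)
Section TwistedAction.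
Variables (K : fieldType) (n : nat) (A : comNzRingType).
Variables (phi : {rmorphism {mpoly K[n]} -> A}) (d : 'I_n -> {additive A -> A}).
Variable w : 'I_n -> A.
Hypothesis dM : forall i a b, d i (a * b) = d i a * b + a * d i b.
Hypothesis d_phi : forall i p, d i (phi p) = phi p^`M(i).
Hypothesis d_comm : forall i j a, d i (d j a) = d j (d i a).
Hypothesis w_closed : forall i j, d i (w j) = d j (w i).

Definition tw_const (c : K) : A := phi c%:MP.
HB.instance Definition _ := GRing.RMorphism.copy tw_const (phi \o @mpolyC n K).

Definition tw_x (i : 'I_n) (u : {poly A}) : {poly A} := (phi 'X_i)%:P * u.

Definition tw_d (i : 'I_n) (u : {poly A}) : {poly A} :=
  map_poly (d i) u + 'X * u * (w i)%:P.

Lemma tw_x_is_additive i : zmod_morphism (tw_x i).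
Proof. exact: mulrBr. Qed.
HB.instance Definition _ i :=
  GRing.isZmodMorphism.Build _ _ (tw_x i) (tw_x_is_additive i).

Lemma tw_d_is_additive i : zmod_morphism (tw_d i).
Proof. by move=> u v; rewrite /tw_d raddfB /=; ring. Qed.
HB.instance Definition _ i :=
  GRing.isZmodMorphism.Build _ _ (tw_d i) (tw_d_is_additive i).

Lemma map_derivM i (u v : {poly A}) :
  map_poly (d i) (u * v) = map_poly (d i) u * v + u * map_poly (d i) v.
Proof.
apply/polyP => k; rewrite coefD coef_map !coefM raddf_sum -big_split /=.
by apply: eq_bigr => j _; rewrite dM !coef_map.
Qed.

Lemma map_derivX i : map_poly (d i) 'X = 0.
Proof.
apply/polyP => k; rewrite coef_map coefX coef0 /=.
by rewrite -(rmorph_nat phi) d_phi -mpolyC_nat mderivC raddf0.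
Qed.

Lemma map_deriv_comm i j (u : {poly A}) :
  map_poly (d i) (map_poly (d j) u) = map_poly (d j) (map_poly (d i) u).
Proof. by apply/polyP => k; rewrite !coef_map /= d_comm. Qed.

(* Leibniz rule *)
Lemma tw_dM i (v u : {poly A}) :
  tw_d i (v * u) = map_poly (d i) v * u + v * tw_d i u.
Proof. by rewrite /tw_d map_derivM; ring. Qed.

Lemma tw_xZ i c u : tw_x i (tw_const c *: u) = tw_const c *: tw_x i u.
Proof. by rewrite /tw_x scalerAr. Qed.

Lemma tw_dZ i c u : tw_d i (tw_const c *: u) = tw_const c *: tw_d i u.
Proof.
rewrite -!mul_polyC tw_dM map_polyC /= d_phi mderivC raddf0 polyC0.
rewrite (mul0r u).
rewrite add0r.
reflexivity.
Qed.

Lemma tw_xx i j u : tw_x i (tw_x j u) = tw_x j (tw_x i u).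
Proof. by rewrite /tw_x mulrCA. Qed.

Lemma tw_dd i j u : tw_d i (tw_d j u) = tw_d j (tw_d i u).
Proof.
rewrite /tw_d !raddfD /= !map_derivM !map_derivX !map_polyC /= !mul0r !add0r.
by rewrite (w_closed i j) (map_deriv_comm i j); exact: twistC.
Qed.

Lemma tw_dx i j u : tw_d i (tw_x j u) = tw_x j (tw_d i u) + u *+ (i == j).
Proof.
rewrite /tw_x tw_dM map_polyC /= d_phi addrC; congr (_ + _).
rewrite mderivX mnmE; case: (eqVneq j i) => [->|_].
  have -> : (U_(i) - U_(i) = 0)%MM by apply/mnmP => k; rewrite !mnmE subnn.
  by rewrite scale1r mpolyX0 rmorph1 polyC1 mul1r.
by rewrite scale0r raddf0 polyC0 mul0r mulr0n.
Qed.

(* The action of the Weyl algebra determined by that of its generators. *)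
Definition weyl_act (P : weyl K n) (u : {poly A}) : {poly A} :=
  free_act tw_const tw_x tw_d (repr P) u.

Lemma weyl_act_pi a u :
  weyl_act (weyl_pi a) u = free_act tw_const tw_x tw_d a u.
Proof.
rewrite /weyl_act; apply/eqP; rewrite -subr_eq0 -free_actNl -free_actDl.
apply/eqP/free_act_ideal; [exact: tw_xZ | exact: tw_dZ | exact: tw_xx
  | exact: tw_dd | exact: tw_dx | ].
by apply/weyl_piP; rewrite weyl_piK.
Qed.

Lemma weyl_act_is_additive P : zmod_morphism (weyl_act P).
Proof. by move=> u v; rewrite /weyl_act raddfB. Qed.
HB.instance Definition _ P :=
  GRing.isZmodMorphism.Build _ _ (weyl_act P) (weyl_act_is_additive P).

Lemma weyl_actDl P Q u : weyl_act (P + Q) u = weyl_act P u + weyl_act Q u.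
Proof.
rewrite -[P]weyl_piK -[Q]weyl_piK -raddfD !weyl_act_pi.
exact: free_actDl.
Qed.

Lemma weyl_actM P Q u : weyl_act (P * Q) u = weyl_act P (weyl_act Q u).
Proof.
rewrite -[P]weyl_piK -[Q]weyl_piK -rmorphM !weyl_act_pi.
by rewrite free_actM //; [exact: tw_xZ | exact: tw_dZ].
Qed.

Lemma weyl_act1 u : weyl_act 1 u = u.
Proof. by rewrite -(rmorph1 (@weyl_pi K n)) weyl_act_pi free_act1. Qed.

Lemma weyl_act0 u : weyl_act 0 u = 0.
Proof. by rewrite -(raddf0 (@weyl_pi K n)) weyl_act_pi free_act0l. Qed.

Lemma weyl_act_x i u : weyl_act (weyl_x K i) u = (phi 'X_i)%:P * u.
Proof. by rewrite weyl_act_pi free_act_x. Qed.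

Lemma weyl_act_d i u : weyl_act (weyl_d K i) u = tw_d i u.
Proof. by rewrite weyl_act_pi free_act_d. Qed.

Lemma weyl_act_const c u : weyl_act (weyl_const n c) u = (phi c%:MP)%:P * u.
Proof. by rewrite weyl_act_pi free_actU fm1 mul_polyC. Qed.

Lemma weyl_act_sum (T : Type) (r : seq T) (F : T -> weyl K n) u :
  weyl_act (\sum_(t <- r) F t) u = \sum_(t <- r) weyl_act (F t) u.
Proof.
by apply: (big_morph (fun a => weyl_act a u)) => [a b|];
  rewrite (weyl_actDl, weyl_act0).
Qed.

Lemma weyl_act_poly p u : weyl_act (weyl_poly p) u = (phi p)%:P * u.
Proof.
have actX (a : A) (P : weyl K n) k : (forall v, weyl_act P v = a%:P * v) ->
    forall v, weyl_act (P ^+ k) v = (a ^+ k)%:P * v.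
  move=> hP; elim: k => [|k IH] v; first by rewrite !expr0 weyl_act1 polyC1 mul1r.
  by rewrite !exprS weyl_actM IH hP polyCM mulrA.
rewrite {2}[p]mpolyE raddf_sum raddf_sum mulr_suml /= /weyl_poly /mmap.
rewrite weyl_act_sum; apply: eq_bigr => m _.
rewrite -mul_mpolyC rmorphM weyl_actM weyl_act_const polyCM -mulrA.
congr (_ * _); rewrite mpolyXE_id /mmap1 rmorph_prod.
elim: (index_enum _) => [|i r IH]; first by rewrite !big_nil weyl_act1 mul1r.
rewrite !big_cons weyl_actM IH polyCM -mulrA rmorphXn.
by apply: actX => v; rewrite weyl_act_x.
Qed.

Lemma weyl_actXs P k u : weyl_act P ('X^k * u) = 'X^k * weyl_act P u.
Proof.
have hg t v : gen_act tw_x tw_d t ('X * v) = 'X * gen_act tw_x tw_d t v.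
  case: t => i /=; first by rewrite /tw_x mulrCA.
  by rewrite tw_dM map_derivX mul0r add0r.
have hs v : weyl_act P ('X * v) = 'X * weyl_act P v.
  rewrite /weyl_act /free_act mulr_sumr; apply: eq_bigr => z _.
  rewrite -scalerAr; congr (_ *: _); elim: (z : seq _) => //= t r ->.
  exact: hg.
by elim: k u => [|k IH] u; rewrite ?expr0 ?mul1r // exprS -!mulrA hs IH.
Qed.

(* The action of D[s], with s acting by multiplication. *)
Definition ds_act (P : {poly weyl K n}) (u : {poly A}) : {poly A} :=
  \sum_(k < size P) 'X^k * weyl_act P`_k u.

Lemma ds_actEw N (P : {poly weyl K n}) u : (size P <= N)%N ->
  ds_act P u = \sum_(k < N) 'X^k * weyl_act P`_k u.
Proof.
move=> le; rewrite /ds_act (big_ord_widen _ (fun k => 'X^k * weyl_act P`_k u) le).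
rewrite big_mkcond /=; apply: eq_bigr => k _; case: ifPn => //.
by rewrite -leqNgt => /leq_sizeP -> //; rewrite weyl_act0 mulr0.
Qed.

Lemma ds_actDl u P Q : ds_act (P + Q) u = ds_act P u + ds_act Q u.
Proof.
pose N := maxn (size P) (size Q).
rewrite (@ds_actEw N) ?size_polyD // (@ds_actEw N P) ?leq_maxl //.
rewrite (@ds_actEw N Q) ?leq_maxr // -big_split /=; apply: eq_bigr => k _.
by rewrite coefD weyl_actDl mulrDr.
Qed.

Lemma ds_actDr P u v : ds_act P (u + v) = ds_act P u + ds_act P v.
Proof.
rewrite /ds_act -big_split /=; apply: eq_bigr => k _.
by rewrite -mulrDr; congr (_ * _); rewrite -raddfD.
Qed.

Lemma ds_act0l u : ds_act 0 u = 0.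
Proof. by rewrite /ds_act size_poly0 big_ord0. Qed.

Lemma ds_act_suml (T : Type) (r : seq T) (F : T -> {poly weyl K n}) u :
  ds_act (\sum_(t <- r) F t) u = \sum_(t <- r) ds_act (F t) u.
Proof.
by apply: (big_morph (fun a => ds_act a u)) => [a b|];
  rewrite (ds_actDl, ds_act0l).
Qed.

Lemma ds_act_monom (P : weyl K n) k u :
  ds_act (P%:P * 'X^k) u = 'X^k * weyl_act P u.
Proof.
rewrite (@ds_actEw k.+1); last first.
  apply: leq_trans (size_polyMleq _ _) _.
  by rewrite size_polyXn addnS /= -add1n leq_add2r size_polyC_leq1.
have z (j : 'I_k) : 'X^j * weyl_act (P%:P * 'X^k)`_j u = 0.
  by rewrite coefCM coefXn ltn_eqF // mulr0 weyl_act0 mulr0.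
rewrite big_ord_recr /= big1 => [|j _]; last exact: z.
by rewrite add0r coefCM coefXn eqxx mulr1.
Qed.

Lemma ds_actA P Q u : ds_act P (ds_act Q u) = ds_act (P * Q) u.
Proof.
have PE (S : {poly weyl K n}) : S = \sum_(k < size S) (S`_k)%:P * 'X^k.
  by rewrite -{1}[S]coefK poly_def; apply: eq_bigr => k _; rewrite mul_polyC.
rewrite {2}(PE P) mulr_suml ds_act_suml {1}/ds_act; apply: eq_bigr => k _.
have -> : (P`_k)%:P * 'X^k * Q
    = \sum_(l < size Q) (P`_k * Q`_l)%:P * 'X^(k + l).
  rewrite {1}(PE Q) mulr_sumr; apply: eq_bigr => l _.
  by rewrite polyCM exprD -!mulrA; congr (_ * _); rewrite mulrA -(commr_polyXn (Q`_l)%:P) mulrA.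
rewrite ds_act_suml {1}/ds_act raddf_sum mulr_sumr; apply: eq_bigr => l _.
by rewrite /= ds_act_monom exprD -mulrA weyl_actM weyl_actXs.
Qed.

Lemma ds_act1 u : ds_act 1 u = u.
Proof.
have -> : 1 = 1%:P * 'X^0 :> {poly weyl K n} by rewrite expr0 mulr1.
by rewrite ds_act_monom expr0 mul1r weyl_act1.
Qed.

End TwistedAction.

Section FGS.
Variables (K : fieldType) (n : nat) (f g : {mpoly K[n]}).
Local Notation L := (loc (f * g)).
Local Notation LP := (@loc_poly K n (f * g)).

(* 1/f = g/(fg) and 1/g = f/(fg) *)
Definition loc_invf : L := loc_frac (f * g) g 1.
Definition loc_invg : L := loc_frac (f * g) f 1.

Lemma loc_invfP : f != 0 -> g != 0 -> LP f * loc_invf = 1.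
Proof.
move=> f0 g0; apply: val_inj; rewrite /= expr1 mulrA -tofracM.
by rewrite divff // tofrac_eq0 mulf_neq0.
Qed.

Lemma loc_invgP : f != 0 -> g != 0 -> LP g * loc_invg = 1.
Proof.
move=> f0 g0; apply: val_inj; rewrite /= expr1 mulrA -tofracM mulrC.
by rewrite [g * f]mulrC mulVf // tofrac_eq0 mulf_neq0.
Qed.

Lemma loc_inv0 : f * g = 0 -> (loc_invf = 0) * (loc_invg = 0).
Proof.
move=> fg0; split; apply: val_inj;
  by rewrite /= fg0 tofrac0 expr1 invr0 mulr0.
Qed.

(* df/f - dg/g *)
Definition dlog (i : 'I_n) : L :=
  LP f^`M(i) * loc_invf - LP g^`M(i) * loc_invg.

Lemma loc_deriv_inv i (a b : L) : a * b = 1 ->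
  loc_deriv i b = - (loc_deriv i a * b ^+ 2).
Proof.
move=> ab1; have d1 : loc_deriv i (1 : L) = 0.
  by rewrite -(rmorph1 LP) loc_deriv_poly mderivC raddf0.
have := d1; rewrite -ab1 loc_derivM => h.
have -> : loc_deriv i b = b * (a * loc_deriv i b) by rewrite mulrCA mulrA ab1 mul1r.
rewrite (_ : a * loc_deriv i b = - (loc_deriv i a * b)).
  by rewrite mulrN mulrCA expr2.
by apply/eqP; rewrite -addr_eq0 addrC h.
Qed.

Lemma dlog_closed i j : loc_deriv i (dlog j) = loc_deriv j (dlog i).
Proof.
have [fg0|] := eqVneq (f * g) 0.
  have [h1 h2] := loc_inv0 fg0.
  by rewrite /dlog h1 h2 !mulr0 subrr !raddf0.
rewrite mulf_eq0 negb_or => /andP[f0 g0].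
rewrite /dlog !raddfB /= !loc_derivM !loc_deriv_poly.
rewrite !(loc_deriv_inv _ (loc_invfP f0 g0)) !(loc_deriv_inv _ (loc_invgP f0 g0)).
rewrite !loc_deriv_poly (mderiv_comm i j f) (mderiv_comm i j g).
exact: dlogC.
Qed.

(* The element u (f/g)^s is represented by its coordinate u, seen as a
   polynomial in s with coefficients in K[x, 1/(fg)]. *)
Definition fgs : Type := {poly L}.
HB.instance Definition _ := GRing.Zmodule.on fgs.

Definition fgs_act (P : {poly weyl K n}) (u : fgs) : fgs :=
  ds_act LP (@loc_deriv K n (f * g)) dlog P u.

Lemma fgs_actA P Q u : fgs_act P (fgs_act Q u) = fgs_act (P * Q) u.
Proof.
by apply: ds_actA; [exact: loc_derivM | exact: loc_deriv_poly
  | exact: loc_deriv_comm | exact: dlog_closed].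
Qed.

Lemma fgs_act1 u : fgs_act 1 u = u.
Proof.
by apply: ds_act1; [exact: loc_derivM | exact: loc_deriv_poly
  | exact: loc_deriv_comm | exact: dlog_closed].
Qed.

Lemma fgs_actDr P u v : fgs_act P (u + v) = fgs_act P u + fgs_act P v.
Proof. exact: ds_actDr. Qed.

Lemma fgs_actDl u P Q : fgs_act (P + Q) u = fgs_act P u + fgs_act Q u.
Proof.
by apply: ds_actDl; [exact: loc_derivM | exact: loc_deriv_poly
  | exact: loc_deriv_comm | exact: dlog_closed].
Qed.

HB.instance Definition _ := GRing.Zmodule_isLmodule.Build {poly weyl K n} fgs
  fgs_actA fgs_act1 fgs_actDr fgs_actDl.

Lemma fgs_scaleC P u :
  P%:P *: (u : fgs) = weyl_act LP (@loc_deriv K n (f * g)) dlog P u.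
Proof.
have -> : P%:P = P%:P * 'X^0 by rewrite expr0 mulr1.
rewrite -[LHS]/(fgs_act _ _) /fgs_act ds_act_monom ?expr0 ?mul1r //;
  [exact: loc_derivM | exact: loc_deriv_poly
  | exact: loc_deriv_comm | exact: dlog_closed].
Qed.

Lemma fgs_scale_poly p (u : {poly L}) :
  (weyl_poly p)%:P *: (u : fgs) = (LP p)%:P * u.
Proof.
by rewrite fgs_scaleC weyl_act_poly; [|exact: loc_derivM | exact: loc_deriv_poly
  | exact: loc_deriv_comm | exact: dlog_closed].
Qed.

Lemma fgs_scale_s (u : {poly L}) : 'X *: (u : fgs) = 'X * u.
Proof.
have -> : 'X = 1%:P * 'X^1 :> {poly weyl K n} by rewrite mul1r expr1.
rewrite -[LHS]/(fgs_act _ _) /fgs_act.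
rewrite ds_act_monom; [|exact: loc_derivM | exact: loc_deriv_poly
  | exact: loc_deriv_comm | exact: dlog_closed].
by rewrite weyl_act1; [|exact: loc_derivM | exact: loc_deriv_poly
  | exact: loc_deriv_comm | exact: dlog_closed].
Qed.

Lemma fgs_scale_d i (u : {poly L}) :
  (weyl_d K i)%:P *: (u : fgs)
  = map_poly (@loc_deriv K n (f * g) i) u
    + 'X * u * (LP f^`M(i) * loc_invf)%:P - 'X * u * (LP g^`M(i) * loc_invg)%:P.
Proof.
transitivity (tw_d (@loc_deriv K n (f * g)) dlog i u).
  by rewrite fgs_scaleC weyl_act_d; [|exact: loc_derivM | exact: loc_deriv_poly
    | exact: loc_deriv_comm | exact: dlog_closed].
by rewrite /tw_d /dlog polyCB mulrBr addrA.
Qed.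

End FGS.

Local Open Scope classical_set_scope.

(** * Ideals of K[s], left ideals and syzygies of D[s] *)

Section MonicGenerator.
Variable K : fieldType.

Definition principal_ideal (b : {poly K}) : set {poly K} := [set a | b %| a].

(* The monic generator of the ideal [I] of K[s], or 0 if [I] is zero. *)
Definition monic_gen (I : set {poly K}) : {poly K} :=
  xget 0 [set b | (b \is monic \/ b = 0) /\ I = principal_ideal b].

Lemma monic_genP (I : set {poly K}) :
  I 0 -> (forall a b, I a -> I b -> I (a + b)) ->
  (forall a b, I b -> I (a * b)) ->
  (monic_gen I \is monic \/ monic_gen I = 0) /\
  I = principal_ideal (monic_gen I).
Proof.
move=> I0 ID IM.
pose S : set {poly K} :=
  [set b | (b \is monic \/ b = 0) /\ I = principal_ideal b].
suff: exists b, S b by exact: (@xgetPex _ 0 S).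
have [hz|/existsNP[a /not_implyP[Ia a0]]] := pselect (forall a, I a -> a = 0).
  exists 0; split; first by right.
  apply/seteqP; split=> a; rewrite /principal_ideal /= dvd0p; first by move/hz->.
  by move=> /eqP->.
pose p k := `[< exists b, [/\ I b, b <> 0 & size b = k] >].
have ex : exists k, p k by exists (size a); apply/asboolP; exists a.
have [k /asboolP[b [Ib b0 sb]] kmin] := find_ex_minn ex.
have lb0 : (lead_coef b)^-1 != 0 by rewrite invr_eq0 lead_coef_eq0; exact/eqP.
exists ((lead_coef b)^-1 *: b); split.
  by left; rewrite monicE lead_coefZ mulVf // -invr_eq0.
apply/seteqP; split=> c; rewrite /principal_ideal /= dvdpZl //; last first.
  by move=> /dvdpP[q ->]; exact: IM.
move=> Ic; apply/modp_eq0P; apply/eqP; apply: contraT => r0.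
have Ir : I (c %% b).
  have -> : c %% b = c + (- (c %/ b)) * b by rewrite {2}(divp_eq c b) mulNr addrC addKr.
  by apply: ID => //; exact: IM.
suff: (size b <= size (c %% b)%R)%N by rewrite leqNgt ltn_modp; move/eqP: b0 => ->.
by rewrite sb; apply: kmin; apply/asboolP; exists (c %% b); split=> //; exact/eqP.
Qed.

End MonicGenerator.

Section Syzygies.
Variable A : nzRingType.

Definition left_ideal_gen (r : nat) (Q : 'I_r -> A) : set A :=
  [set P | exists R : 'I_r -> A, P = \sum_j R j * Q j].

(* Elements (B, R_1, ..., R_r) of A^(r+1) are row vectors. *)
Definition syz (P : A) (r : nat) (Q : 'I_r -> A) : set 'rV[A]_r.+1 :=
  [set v | v 0 ord0 * P + \sum_j v 0 (lift ord0 j) * Q j = 0].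

Definition syz_proj (r : nat) (v : 'rV[A]_r.+1) : A := v 0 ord0.

End Syzygies.

(** * Bernstein-Sato polynomials of f/g *)

Section BernsteinSato.
Variables (K : fieldType) (n : nat) (f g : {mpoly K[n]}).
Local Notation Ds := {poly weyl K n}.
Local Notation LP := (@loc_poly K n (f * g)).

(* The inclusions of K[x] and K[s] in D[s]. *)
Definition ds_poly (p : {mpoly K[n]}) : Ds := (weyl_poly p)%:P.
Definition ds_upoly (b : {poly K}) : Ds := map_poly (weyl_const n) b.

(* 1/g^m (f/g)^(s+k) *)
Definition fgs_pow (m k : nat) : fgs f g :=
  (loc_invg f g ^+ m * (LP f * loc_invg f g) ^+ k)%:P.

Definition ann_ideal (k : nat) : set Ds := [set P | P *: fgs_pow k 0 = 0].

Definition bs_ideal (m N : nat) : set {poly K} :=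
  [set b | exists P : nat -> Ds,
    ds_upoly b *: fgs_pow m 0 = \sum_(1 <= k < N.+1) P k *: fgs_pow m k].

Definition bs_poly (m N : nat) : {poly K} := monic_gen (bs_ideal m N).

Definition J_ideal (m N : nat) : set Ds :=
  [set P | exists Q (A : nat -> Ds), ann_ideal (m + N) Q /\
    P = Q + \sum_(1 <= k < N.+1) A k * ds_poly (f ^+ k * g ^+ (N - k))].

End BernsteinSato.

(* Main.v *)
Require Import Defs.
From mathcomp Require Import all_boot all_order all_algebra.
From mathcomp Require Import complex boolp classical_sets reals mpoly.

Import GRing.Theory.
Local Open Scope ring_scope.
Local Open Scope classical_set_scope.

(** Put e := 1/g^(m+N) (f/g)^s. Since f^k g^(N-k) e = 1/g^m (f/g)^(s+k) for
    0 <= k <= N, applying both sides of b g^N = Q + \sum_k A_k f^k g^(N-k) to e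
    kills Q in I_(m+N)(s) and turns membership of b g^N in J into the functional
    equation defining the Bernstein-Sato ideal. *)

(** The remaining entries of a syzygy are the negated coefficients of [a * P] on the [Q j]. Hence
    the projection depends only on the left ideal, not on its generators. *)
Lemma syz_proj_image (A : nzRingType) (P : A) (r : nat) (Q : 'I_r -> A) :
  @syz_proj A r @` syz P Q = [set a | left_ideal_gen Q (a * P)].
Proof.
apply/seteqP; split=> [_ [v + <-]|a [S aP]].
  rewrite /syz /= => h; exists (fun j => - v 0 (lift ord0 j)).
  under eq_bigr do rewrite mulNr.
  by rewrite sumrN; apply/eqP; rewrite -addr_eq0; apply/eqP.
exists (\row_j if unlift ord0 j is Some j' then - S j' else a).
  rewrite /syz /= mxE unlift_none aP.
  under [X in _ + X]eq_bigr do rewrite mxE liftK mulNr.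
  by rewrite sumrN subrr.
by rewrite /syz_proj mxE unlift_none.
Qed.

(** With [v] inverse to [b], the power [b ^+ (N - k)] cancels [N - k] of the [m + N] factors [v] and
    leaves [m + k]; [k <= N] keeps the subtraction from truncating. *)
Lemma expr_inv_cancel (A : comNzRingType) (a b v : A) (m N k : nat) :
  (k <= N)%N -> b * v = 1 ->
  a ^+ k * b ^+ (N - k) * v ^+ (m + N) = v ^+ m * (a * v) ^+ k.
Proof.
move=> kN bv1; have -> : (m + N = (N - k) + (m + k))%N by rewrite addnCA subnK.
by rewrite exprD -mulrA (mulrA (b ^+ _)) -exprMn bv1 expr1n mul1r exprD exprMn mulrCA.
Qed.

Section BernsteinSatoIdeal.
Context {K : fieldType} {n : nat} (f g : {mpoly K[n]}).
Hypotheses (f0 : f != 0) (g0 : g != 0).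

Lemma ds_poly_fgs_pow (m N k : nat) : (k <= N)%N ->
  ds_poly (f ^+ k * g ^+ (N - k)) *: fgs_pow f g (m + N) 0 = fgs_pow f g m k.
Proof.
move=> kN; rewrite /ds_poly /fgs_pow fgs_scale_poly -polyCM expr0 mulr1.
congr (_%:P); rewrite rmorphM !rmorphXn /=; apply: expr_inv_cancel => //.
exact: loc_invgP.
Qed.

Lemma bs_idealE (m N : nat) :
  bs_ideal f g m N
  = [set b | J_ideal f g m N (@ds_upoly K n b * ds_poly (g ^+ N))].
Proof.
have gN : ds_poly (g ^+ N) *: fgs_pow f g (m + N) 0 = fgs_pow f g m 0.
  (* The case k = 0. *)
  by have := ds_poly_fgs_pow m N 0 (leq0n N); rewrite expr0 mul1r subn0.
have sumE (A : nat -> {poly weyl K n}) :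
    (\sum_(1 <= k < N.+1) A k * ds_poly (f ^+ k * g ^+ (N - k)))
      *: fgs_pow f g (m + N) 0
    = \sum_(1 <= k < N.+1) A k *: fgs_pow f g m k.
  rewrite scaler_suml; apply: eq_big_nat => k /andP[_ kN].
  by rewrite -scalerA ds_poly_fgs_pow.
apply/seteqP; split=> b /=.
  (* Q is forced to be this difference; the functional equation says exactly that it annihilates
     e. *)
  move=> [A bE]; exists (@ds_upoly K n b * ds_poly (g ^+ N)
    - \sum_(1 <= k < N.+1) A k * ds_poly (f ^+ k * g ^+ (N - k))), A.
  split; last by rewrite subrK.
  rewrite /ann_ideal /= scalerBl sumE -scalerA gN bE.
  exact: subrr.
move=> [Q [A [Q0 bE]]]; exists A.
by rewrite -gN scalerA bE scalerDl Q0 add0r sumE.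
Qed.

(** [bs_ideal] is closed under sums and multiples, since operators can be added and multiplied on
    the left by polynomials in s, so [monic_gen] does generate it. *)
Lemma bs_ideal_principal (m N : nat) :
  bs_ideal f g m N = principal_ideal (bs_poly f g m N).
Proof.
have up0 : @ds_upoly K n 0 = 0 by exact: rmorph0.
have upD : {morph @ds_upoly K n : a b / a + b} by exact: rmorphD.
have upM : {morph @ds_upoly K n : a b / a * b} by exact: rmorphM.
apply: (proj2 (monic_genP _ _ _)).
- exists (fun=> 0).
  by rewrite up0 [LHS]scale0r; symmetry; apply: big1 => k _; exact: scale0r.
- move=> a b [A aE] [B bE]; exists (fun k => A k + B k).
  rewrite upD [LHS]scalerDl [X in X + _ = _]aE [X in _ + X = _]bE -big_split.
  by apply: eq_bigr => k _; rewrite [RHS]scalerDl.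
move=> a b [B bE]; exists (fun k => @ds_upoly K n a * B k).
rewrite upM -[LHS]scalerA [X in _ *: X = _]bE [LHS]scaler_sumr.
by apply: eq_bigr => k _; rewrite [LHS]scalerA.
Qed.

End BernsteinSatoIdeal.

Theorem mainTheorem3 (R : realType) (n : nat) (f g : {mpoly R[i][n]})
    (hf : (1 < msize f)%N) (hg : (1 < msize g)%N)
    (m N : nat) (hN : (1 <= N)%N) :
  (forall (r : nat) (Q : 'I_r -> {poly weyl R[i] n}),
     left_ideal_gen Q = J_ideal f g m N ->
     @ds_upoly R[i] n @^-1` (@syz_proj _ r @` syz (ds_poly (g ^+ N)) Q)
       = principal_ideal (bs_poly f g m N))
  /\ @ds_upoly R[i] n @^-1` [set A | J_ideal f g m N (A * ds_poly (g ^+ N))]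
       = principal_ideal (bs_poly f g m N).
Proof.
(* Both being nonzero makes [loc_invg] an inverse of g in the localization. *)
have f0 : f != 0 by apply: contraTneq hf => ->; rewrite msize0.
have g0 : g != 0 by apply: contraTneq hg => ->; rewrite msize0.
rewrite -(bs_ideal_principal f g) (bs_idealE f g f0 g0).
(* The second conjunct now holds by unfolding the preimage; the first reduces to it. *)
by split=> // r Q QJ; rewrite syz_proj_image QJ.
Qed.
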